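(* Let $a,b,c,d$ be real numbers such that the integral converges and the expressions below are defined. Then \[ \int_0^1\!\!\int_0^1\frac{(xy)^b\left[(xy)^{d-1}-x^{a-1}y^{c-1}\right]}{-\left[1-(xy)^b\right]\log(xy)}\,dx\,dy=\sum_{n=1}^\infty\left(\frac{1}{bn+d}-\frac{\log\left(1+\frac{c-a}{bn+a}\right)}{c-a}\right)=\frac{\log\left(\frac{\Gamma\left(\frac{b+c}{b}\right)}{\Gamma\left(\frac{a+b}{b}\right)}\right)}{c-a}-\frac{\psi\left(\frac{b+d}{b}\right)}{b}, \] where $\Gamma$ is Euler's gamma function and $\psi=\Gamma'/\Gamma$ is the digamma function.
   Formalization: The condition that the integral converges and the expressions are defined is made explicit as b>0, a+b>0, c+b>0, d+b>0, c≠a; b<0 is excluded because the first equality then fails in general (e.g. b=−1, a=1/4, c=d=1/2). *)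

(* Defs.v *)
From HB Require Import structures.
From mathcomp Require Import all_boot all_order all_algebra.
From mathcomp Require Import all_classical all_reals all_analysis.
Set Implicit Arguments. Unset Strict Implicit. Unset Printing Implicit Defensive.
Import Order.TTheory GRing.Theory Num.Theory.
Import numFieldNormedType.Exports.
Local Open Scope classical_set_scope.
Local Open Scope ring_scope.

Definition Gamma {R : realType} (x : R) : R :=
  Rintegral (@lebesgue_measure R) `]0, +oo[%classic
    (fun t => t `^ (x - 1) * expR (- t)).

Definition digamma {R : realType} (x : R) : R :=
  (derive1 (@Gamma R) x) / Gamma x.

Definition integrand36 {R : realType} (a b c d x y : R) : R :=
  (x * y) `^ b * ((x * y) `^ (d - 1) - x `^ (a - 1) * y `^ (c - 1))
  / (- (1 - (x * y) `^ b) * ln (x * y)).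

Definition term36 {R : realType} (a b c d : R) (n : nat) : R :=
  1 / (b * n%:R + d) - ln (1 + (c - a) / (b * n%:R + a)) / (c - a).

Definition closed36 {R : realType} (a b c d : R) : R :=
  ln (Gamma ((b + c) / b) / Gamma ((a + b) / b)) / (c - a)
  - digamma ((b + d) / b) / b.

(* Main.v *)
Require Import Defs.
From HB Require Import structures.
From mathcomp Require Import all_boot all_order all_algebra.
From mathcomp Require Import all_classical all_reals all_analysis.
From mathcomp Require Import measurable_realfun.
From mathcomp Require Import ring lra.
Import Order.TTheory GRing.Theory Num.Theory.
Import numFieldNormedType.Exports.
Local Open Scope classical_set_scope.
Local Open Scope ring_scope.

Set Implicit Arguments.
Unset Strict Implicit.
Unset Printing Implicit Defensive.

(* Expanding [1 / (1 - (xy)^b)] as a geometric series and writing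
   [1 / - ln (xy)] as the integral of [(xy)^s] over [s >= 0], Tonelli reduces the
   double integral to the integrals of [1 / ((p + s) (q + s))] over [s >= 0], which
   are the terms of the series.  The exchange of sum and integral is monotone
   convergence, after the integrand has been split as a difference of two
   nonnegative functions by comparison with [(xy)^(m-1)], [m = min a c d].

   For the closed form, [ln Gamma] is convex and satisfies the functional equation,
   so for [z > 1], [h > 0] and an integer [n >= h]
     [h ln (z - 1) <= ln Gamma (z + h) - ln Gamma z <= h ln (z + n)].
   Applied at [z = x + N] and carried back to [x] by the functional equation, this
   gives both the differentiability of [ln Gamma] and
     [digamma x = lim_N (ln N - sum_(i < N) 1 / (x + i))],
   without differentiating under the integral sign. *)

(** * Elementary integrals of exponentials and powers *)

Lemma ge0_FTCy (R : realType) (f F : R -> R) (a l : R) :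
  (forall x, a <= x -> 0 <= f x) ->
  (forall x, a <= x -> {for x, continuous f}) ->
  (forall x, a <= x -> is_derive x 1 F (f x)) ->
  F x @[x --> +oo] --> l ->
  (\int[lebesgue_measure]_(x in `[a, +oo[) (f x)%:E = (l - F a)%:E)%E.
Proof.
move=> f0 cf dF Fl; rewrite (@ge0_continuous_FTC2y _ _ F _ l)//.
- apply/continuous_within_itvcyP; split.
    by move=> x; rewrite in_itv/= andbT => /ltW; exact: cf.
  by apply: cvg_at_right_filter; exact: cf.
- by move=> x /ltW ax; have [] := dF x ax.
- apply: cvg_at_right_filter.
  have [d _] := dF a (lexx a).
  by apply: differentiable_continuous; exact/derivable1_diffP.
- move=> x; rewrite in_itv/= andbT => /ltW ax.
  by rewrite derive1E; have [] := dF x ax.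
Qed.

Lemma FTC_cc (R : realType) (f F : R -> R) (a b : R) : a < b ->
  (forall x, a <= x -> {for x, continuous f}) ->
  (forall x, a <= x -> is_derive x 1 F (f x)) ->
  (\int[lebesgue_measure]_(x in `[a, b]) (f x)%:E = (F b - F a)%:E)%E.
Proof.
move=> ab cf dF.
have cF x : a <= x -> {for x, continuous F}.
  move=> ax; have [d _] := dF x ax.
  by apply: differentiable_continuous; exact/derivable1_diffP.
rewrite (@continuous_FTC2 _ _ F)//.
- apply/continuous_within_itvP => //; split.
  + by move=> x; rewrite in_itv/= => /andP[/ltW ax _]; exact: cf.
  + by apply: cvg_at_right_filter; exact: cf.
  + by apply: cvg_at_left_filter; apply: cf; exact: ltW.
- split.
  + by move=> x; rewrite in_itv/= => /andP[/ltW ax _]; have [] := dF x ax.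
  + by apply: cvg_at_right_filter; exact: cF.
  + by apply: cvg_at_left_filter; apply: cF; exact: ltW.
- move=> x; rewrite in_itv/= => /andP[/ltW ax _].
  by rewrite derive1E; have [] := dF x ax.
Qed.

Lemma is_derive_powR (R : realType) (r x : R) : 0 < x ->
  is_derive x 1 (fun z : R => z `^ r) (r * x `^ (r - 1)).
Proof.
move=> x0; apply: DeriveDef.
  by apply: derivable_powR; rewrite in_itv/= x0.
by rewrite -derive1E powR_derive1// in_itv/= x0.
Qed.

Lemma continuous_powR (R : realType) (r x : R) : 0 < x ->
  {for x, continuous (fun z : R => z `^ r)}.
Proof.
move=> x0; have [d _] := is_derive_powR r x0.
by apply: differentiable_continuous; exact/derivable1_diffP.
Qed.

Lemma integral_expR_ray (R : realType) (k a : R) : 0 < k ->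
  (\int[lebesgue_measure]_(x in `[a, +oo[) (expR (- (k * x)))%:E
   = (expR (- (k * a)) / k)%:E)%E.
Proof.
move=> k0.
apply: (eq_trans (@ge0_FTCy _ _ (fun x => - k^-1 * expR (- (k * x))) _ 0 _ _ _ _)).
- by move=> x _; exact: expR_ge0.
- move=> x _; apply: continuous_comp; last exact: continuous_expR.
  apply: continuousN; apply: continuousM; [exact: cst_continuous|exact: cvg_id].
- move=> x _; apply: is_derive_eq.
  by rewrite /GRing.scale/=; field; rewrite gt_eqF.
- rewrite -[X in _ --> X](mulr0 (- k^-1)); apply: cvgMr.
  apply: (@cvg_comp _ _ _ (fun x => k * x) (fun x => expR (- x)) _ +oo).
    exact: gt0_cvgMry.
  exact: cvgr_expR.
- by congr EFin; rewrite sub0r mulNr opprK mulrC.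
Qed.

Lemma itv0o_bigcup (R : realType) (t : R) : 0 < t ->
  `]0, t]%classic = \bigcup_(n : nat) `[t / (n.+2)%:R, t]%classic.
Proof.
move=> t0; apply/seteqP; split=> x /=.
  rewrite in_itv/= => /andP[x0 xt].
  (* This index works because [t / x] is less than its integer part plus one. *)
  exists (Num.truncn (t / x)) => //=.
  rewrite in_itv/= xt andbT ler_pdivrMr// mulrC -ler_pdivrMr//.
  apply: (le_trans (ltW (truncnS_gt _))).
  by rewrite ler_nat.
move=> [n _ /=]; rewrite !in_itv/= => /andP[nx ->]; rewrite andbT.
by apply: lt_le_trans nx; rewrite divr_gt0.
Qed.

(** For [r < 1] the integrand is unbounded at 0, so the fundamental theorem of calculus is applied
    on [[t / (n + 2), t]] and the interval then grows to []0, t]]. The offset 2 keeps these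
    intervals nondegenerate for every [n]. *)
Lemma integral_powR (R : realType) (r t : R) : 0 < r -> 0 < t ->
  (\int[lebesgue_measure]_(x in `]0%R, t[) (x `^ (r - 1))%:E
   = (t `^ r / r)%:E)%E.
Proof.
move=> r0 t0; rewrite integral_itv_bndo_bndc; last first.
  by apply/measurable_EFinP; apply: measurable_funTS.
rewrite itv0o_bigcup//.
have tn n : 0 < t / (n.+2)%:R :> R by rewrite divr_gt0.
have h := @ge0_nondecreasing_set_cvg_integral _ (measurableTypeR R) R
  (fun n => `[t / (n.+2)%:R, t]%classic) (fun x => (x `^ (r - 1))%:E) lebesgue_measure.
apply: (cvg_unique _ (h _ _ _ _)) => //.
- apply/nondecreasing_seqP => n; rewrite subsetEset.
  apply: subset_itvr; rewrite bnd_simp.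
  by rewrite ler_pM2l// lef_pV2 ?posrE// ler_nat.
- by move=> n; apply/measurable_EFinP; apply: measurable_funTS.
- by move=> n x _; rewrite lee_fin powR_ge0.
- have -> : (fun i : nat => \int[lebesgue_measure]_(x in `[(t / i.+2%:R)%R, t]) (x `^ (r - 1))%:E)%E
     = EFin \o (fun i : nat => t `^ r / r - (t / i.+2%:R) `^ r / r).
    apply/funext => n /=.
    apply: (eq_trans (@FTC_cc _ _ (fun x => r^-1 * x `^ r) _ _ _ _ _)).
    + by rewrite ltr_pdivrMr// ltr_pMr// ltr1n.
    + by move=> x nx; apply: continuous_powR; exact: lt_le_trans nx.
    + move=> x nx; have x0 : 0 < x by exact: lt_le_trans nx.
      have := is_derive_powR r x0 => ?; apply: is_derive_eq.
      by rewrite /GRing.scale/=; field; rewrite gt_eqF.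
    + by congr EFin; rewrite ![_^-1 * _]mulrC.
  apply: cvg_EFin; first exact: nearW.
  rewrite -[X in _ --> X]subr0; apply: cvgB; first exact: cvg_cst.
  rewrite -[X in _ --> X](mul0r r^-1); apply: cvgM; last exact: cvg_cst.
  have : (t / i.+2%:R) @[i --> \oo] --> 0^'+.
    have tn0 : (t / i.+2%:R) @[i --> \oo] --> (0 : R).
      rewrite -[X in _ --> X](mulr0 t); apply: cvgMr.
      by have := @cvg_harmonic R; rewrite -cvg_shiftS.
    move=> A [e /= e0 eA]; move/cvgrPdist_lt: tn0 => /(_ e e0) [N _ NP].
    by exists N => // n Nn; apply: eA => //=; exact: NP.
  by move=> h0; exact: (cvg_comp _ _ h0 (powR_cvg0 r0)).
Qed.

(** * Tonelli and Fubini on a product of two measurable sets *)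

Lemma ge0_tonelli_setX d1 d2 (T1 : measurableType d1) (T2 : measurableType d2)
    (R : realType) (m1 : {sigma_finite_measure set T1 -> \bar R})
    (m2 : {sigma_finite_measure set T2 -> \bar R}) (A : set T1) (B : set T2)
    (f : T1 * T2 -> \bar R) : measurable A -> measurable B ->
  measurable_fun (A `*` B) f -> (forall z, (A `*` B) z -> 0 <= f z)%E ->
  (\int[m1 \x m2]_(z in A `*` B) f z
     = \int[m1]_(x in A) \int[m2]_(y in B) f (x, y))%E /\
  (\int[m1 \x m2]_(z in A `*` B) f z
     = \int[m2]_(y in B) \int[m1]_(x in A) f (x, y))%E.
Proof.
move=> mA mB mf f0.
(* Extended by zero outside the product set, [f] falls under Tonelli on the whole product space; the
   slices off [A] or [B] vanish. *)
have mfAB : measurable_fun setT (f \_ (A `*` B)).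
  by apply/(measurable_restrictT f) => //; exact: measurableX.
have f0AB z : (0 <= (f \_ (A `*` B)) z)%E by exact: erestrict_ge0.
rewrite integral_mkcond; split.
  rewrite fubini_tonelli1// [RHS]integral_mkcond.
  apply: eq_integral => x _; rewrite /fubini_F [RHS]patchE; case: ifPn => xA.
    rewrite [RHS]integral_mkcond; apply: eq_integral => y _.
    by rewrite !patchE/= in_setX/= xA.
  by apply: integral0_eq => y _; rewrite patchE in_setX/= (negbTE xA).
rewrite fubini_tonelli2// [RHS]integral_mkcond.
apply: eq_integral => y _; rewrite /fubini_G [RHS]patchE; case: ifPn => yB.
  rewrite [RHS]integral_mkcond; apply: eq_integral => x _.
  by rewrite !patchE/= in_setX/= yB andbT.
by apply: integral0_eq => x _; rewrite patchE in_setX/= (negbTE yB) andbF.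
Qed.

Lemma integrable_fubini_setX d1 d2 (T1 : measurableType d1) (T2 : measurableType d2)
    (R : realType) (m1 : {sigma_finite_measure set T1 -> \bar R})
    (m2 : {sigma_finite_measure set T2 -> \bar R}) (A : set T1) (B : set T2)
    (f : T1 * T2 -> \bar R) : measurable A -> measurable B ->
  (m1 \x m2)%E.-integrable (A `*` B) f ->
  (\int[m2]_(y in B) \int[m1]_(x in A) f (x, y)
     = \int[m1 \x m2]_(z in A `*` B) f z)%E.
Proof.
move=> mA mB fi; rewrite [RHS]integral_mkcond.
rewrite -integral21_prod_meas1; last first.
  exact/(integrable_mkcond _ (measurableX mA mB)).
rewrite integral_mkcond.
apply: eq_integral => y _; rewrite /fubini_G [LHS]patchE; case: ifPn => yB.
  rewrite [LHS]integral_mkcond; apply: eq_integral => x _.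
  by rewrite !patchE/= in_setX/= yB andbT.
by apply/esym/integral0_eq => x _; rewrite patchE in_setX/= (negbTE yB) andbF.
Qed.

Lemma ge0_integralZl_EFinM d (T : measurableType d) (R : realType)
    (m : {measure set T -> \bar R}) (D : set T) (k : R) (f : T -> R) :
  measurable D -> measurable_fun D f -> (forall x, D x -> 0 <= f x) -> 0 <= k ->
  (\int[m]_(x in D) (k * f x)%:E = k%:E * \int[m]_(x in D) (f x)%:E)%E.
Proof.
move=> mD mf f0 k0; under eq_integral do rewrite EFinM.
by apply: ge0_integralZl => //; exact/measurable_EFinP.
Qed.

(** * The Gamma integral: functional equation, positivity, finiteness *)

Section gamma_integral.
Variable R : realType.
Notation mu := (@lebesgue_measure R).
Implicit Types x y s t : R.

Definition Gamma_integrand (x t : R) : R := t `^ (x - 1) * expR (- t).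

Lemma Gamma_integrand_ge0 x t : 0 <= Gamma_integrand x t.
Proof. by rewrite mulr_ge0// ?powR_ge0 ?expR_ge0. Qed.

Lemma measurable_Gamma_integrand x (D : set R) :
  measurable_fun D (fun t => (Gamma_integrand x t)%:E).
Proof.
apply/measurable_EFinP/measurable_funTS; apply: measurable_funM => //.
exact: measurableT_comp.
Qed.

(** Extended-real valued, so that Tonelli gives the functional equation before finiteness is known;
    finiteness is then deduced from it. *)
Definition eGamma (x : R) : \bar R :=
  (\int[mu]_(t in `]0%R, +oo[) (Gamma_integrand x t)%:E)%E.

(* Tonelli on the triangle [0 < s < t] applied to [s^(x-1) e^(-t)]. *)
Lemma eGammaS x : 0 < x -> eGamma (x + 1) = (x%:E * eGamma x)%E.
Proof.
move=> x0.
pose f (z : R * R) := if z.1 < z.2 then z.1 `^ (x - 1) * expR (- z.2) else 0.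
have f0 z : (0 <= (f z)%:E)%E.
  by rewrite lee_fin /f; case: ifP => // _; rewrite mulr_ge0// ?powR_ge0 ?expR_ge0.
have mf : measurable_fun (setT : set (R * R)) (fun z => (f z)%:E).
  apply/measurable_EFinP; apply: measurable_fun_ifT => //.
    exact: measurable_fun_ltr.
  apply: measurable_funM.
    exact: (measurableT_comp (measurable_powR (x - 1)) measurable_fst).
  apply: measurableT_comp; first exact: measurable_expR.
  exact: measurableT_comp.
have [e1 e2] := @ge0_tonelli_setX _ _ _ _ R mu mu `]0, +oo[%classic `]0, +oo[%classic
  (fun z => (f z)%:E) (measurable_itv _) (measurable_itv _)
  (measurable_funTS mf) (fun z _ => f0 z).
move: e1; rewrite e2 => {e2}.
(* Slices at fixed [s] give the integrand of [eGamma x]; slices at fixed [t], treated next, give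
   that of [eGamma (x + 1)] divided by [x]. *)
have e1 (s : R) : 0 < s -> (\int[mu]_(t in `]0%R, +oo[) (f (s, t))%:E)%E
    = (Gamma_integrand x s)%:E.
  move=> s0.
  have -> : (\int[mu]_(t in `]0%R, +oo[) (f (s, t))%:E =
    \int[mu]_(t in `]s, +oo[) (s `^ (x - 1) * expR (- t))%:E)%E.
    rewrite -[in RHS](_ : `]0, +oo[%classic `&` `]s, +oo[%classic = `]s, +oo[%classic).
      rewrite integral_mkcondr; apply: eq_integral => t _.
      rewrite patchE /f/=; case: ifPn => st; case: ifPn => //.
        by rewrite notin_setE/= in_itv/= st.
      by rewrite inE/= in_itv/= (negbTE st).
    apply/seteqP; split=> t/=; rewrite !in_itv/= !andbT; first by case.
    by move=> st; split => //; exact: lt_trans st.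
  rewrite ge0_integralZl_EFinM ?powR_ge0//; first last.
    by apply: measurable_funTS; exact: measurableT_comp.
  rewrite integral_itv_obnd_cbnd; last first.
    by apply/measurable_EFinP/measurable_funTS; exact: measurableT_comp.
  have := @integral_expR_ray R 1 s ltr01.
  under eq_integral do rewrite mul1r.
  by move=> ->; rewrite mul1r divr1 -EFinM.
have e2 (t : R) : 0 < t -> (\int[mu]_(s in `]0%R, +oo[) (f (s, t))%:E)%E
    = (x^-1 * Gamma_integrand (x + 1) t)%:E.
  move=> t0.
  have -> : (\int[mu]_(s in `]0%R, +oo[) (f (s, t))%:E =
    \int[mu]_(s in `]0%R, t[) (s `^ (x - 1) * expR (- t))%:E)%E.
    rewrite -[in RHS](_ : `]0, +oo[%classic `&` `]-oo, t[%classic = `]0, t[%classic).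
      rewrite integral_mkcondr; apply: eq_integral => s _.
      rewrite patchE /f/=; case: ifPn => st; case: ifPn => //.
        by rewrite notin_setE/= in_itv/= st.
      by rewrite inE/= in_itv/= (negbTE st).
    apply/seteqP; split=> s/=; rewrite !in_itv/= ?andbT; first by case=> -> ->.
    by move=> /andP.
  under eq_integral do rewrite mulrC.
  rewrite ge0_integralZl_EFinM ?expR_ge0//; first last.
    by move=> s _; exact: powR_ge0.
    exact: measurable_funTS.
  rewrite integral_powR// -!EFinM; congr EFin.
  by rewrite /Gamma_integrand addrK; ring.
have -> : (\int[mu]_(y in `]0%R, +oo[) \int[mu]_(z in `]0%R, +oo[) (f (z, y))%:E
   = x^-1%:E * eGamma (x + 1))%E.
  rewrite -ge0_integralZl_EFinM ?invr_ge0 ?ltW//; first last.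
    by move=> t _; exact: Gamma_integrand_ge0.
    by apply/measurable_EFinP; exact: measurable_Gamma_integrand.
  by apply: eq_integral => t; rewrite inE/= in_itv/= andbT; exact: e2.
have -> : (\int[mu]_(y in `]0%R, +oo[) \int[mu]_(z in `]0%R, +oo[) (f (y, z))%:E
   = eGamma x)%E.
  by apply: eq_integral => t; rewrite inE/= in_itv/= andbT; exact: e1.
by move=> <-; rewrite muleA -EFinM divff ?gt_eqF// mul1e.
Qed.

(** On []0, 1[] the factor [expR (- t)] is at least [expR (-1)], and the integral of the power there
    is [1 / x]. *)
Lemma eGamma_gt0 x : 0 < x -> (0 < eGamma x)%E.
Proof.
move=> x0; apply: (@lt_le_trans _ _ (expR (-1) * (1 `^ x / x))%:E).
  by rewrite lte_fin mulr_gt0// ?expR_gt0// divr_gt0// powR_gt0.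
rewrite EFinM -integral_powR// -ge0_integralZl_EFinM ?expR_ge0//; first last.
  by move=> s _; exact: powR_ge0.
  exact: measurable_funTS.
apply: (@le_trans _ _ (\int[mu]_(t in `]0%R, 1%R[) (Gamma_integrand x t)%:E)%E).
  apply: ge0_le_integral => //=.
  - by move=> t _; rewrite lee_fin mulr_ge0// ?powR_ge0 ?expR_ge0.
  - apply/measurable_EFinP; apply: measurable_funM => //.
    exact: measurable_funTS.
  - exact: measurable_Gamma_integrand.
  - move=> t; rewrite in_itv/= => /andP[t0 t1].
    rewrite lee_fin mulrC ler_wpM2l ?powR_ge0//.
    by rewrite ler_expR lerN2 ltW.
apply: ge0_subset_integral => //=.
- exact: measurable_Gamma_integrand.
- by move=> t _; rewrite lee_fin Gamma_integrand_ge0.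
- by apply: subset_itvl.
Qed.

(** For [x <= 1] the integral is split at 1: the integrand is at most [t^(x-1)] on the left and at
    most [expR (- t)] on the right. Larger arguments are lowered into this range by the functional
    equation, by induction on an integer bound for [x]. *)
Lemma eGamma_lty x : 0 < x -> (eGamma x < +oo)%E.
Proof.
have base y : 0 < y -> y <= 1 -> (eGamma y < +oo)%E.
  move=> y0 y1; rewrite /eGamma.
  have -> : `]0, +oo[%classic = `]0, 1[%classic `|` `[1, +oo[%classic :> set R.
    by rewrite -itv_bndbnd_setU// bnd_simp.
  rewrite ge0_integral_setU//; last 3 first.
    exact: measurable_Gamma_integrand.
    by move=> t _; rewrite lee_fin Gamma_integrand_ge0.
    apply/disj_setPS => t [/=]; rewrite !in_itv/= => /andP[_ t1].
    by rewrite andbT leNgt t1.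
  apply: lte_add_pinfty.
    apply: (@le_lt_trans _ _ (1 `^ y / y)%:E); last exact: ltry.
    rewrite -integral_powR//; apply: ge0_le_integral => //=.
    - by move=> t _; rewrite lee_fin Gamma_integrand_ge0.
    - exact: measurable_Gamma_integrand.
    - by apply/measurable_EFinP/measurable_funTS.
    - move=> t; rewrite in_itv/= => /andP[t0 t1].
      rewrite lee_fin ler_piMr ?powR_ge0//.
      by rewrite expR_le1 oppr_le0 ltW.
  apply: (@le_lt_trans _ _ (expR (- (1 * 1)) / 1)%:E); last exact: ltry.
  rewrite -integral_expR_ray//; apply: ge0_le_integral => //=.
  - by move=> t _; rewrite lee_fin Gamma_integrand_ge0.
  - exact: measurable_Gamma_integrand.
  - apply/measurable_EFinP/measurable_funTS; apply: measurableT_comp => //.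
    by apply: measurableT_comp => //; exact: measurable_funM.
  - move=> t; rewrite in_itv/= andbT => t1.
    rewrite lee_fin mul1r ler_piMl ?expR_ge0//.
    rewrite -[leRHS](powRr0 t); apply: ler_powR => //.
    by rewrite subr_le0.
have step n : forall y, 0 < y -> y <= n.+1%:R -> (eGamma y < +oo)%E.
  elim: n => [|n IH] y y0 yn; first exact: base.
  have [y1|y1] := leP y 1; first exact: base.
  rewrite -(subrK 1 y) eGammaS ?subr_gt0// lte_mul_pinfty//.
    by rewrite lee_fin subr_ge0 ltW.
  by apply: IH; rewrite ?subr_gt0// lerBlDr natr1.
move=> x0; apply: (step (Num.truncn x)) => //.
exact/ltW/truncnS_gt.
Qed.

End gamma_integral.

(** * Convexity of [ln Gamma] and bounds on its slopes *)

Section log_gamma.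
Variable R : realType.
Notation mu := (@lebesgue_measure R).
Implicit Types x y z h t : R.

Lemma eGammaE x : 0 < x -> eGamma x = (Gamma x)%:E.
Proof.
move=> x0; rewrite fineK// ge0_fin_numE ?eGamma_lty//.
by rewrite ltW// eGamma_gt0.
Qed.

Lemma Gamma_gt0 x : 0 < x -> 0 < Gamma x.
Proof. by move=> x0; rewrite -lte_fin -eGammaE// eGamma_gt0. Qed.

Lemma GammaS x : 0 < x -> Gamma (x + 1) = x * Gamma x.
Proof.
move=> x0; apply/EFin_inj; rewrite EFinM -!eGammaE ?eGammaS//.
by rewrite addr_gt0.
Qed.

(** The tangent to [expR] at the mean point [M] lies below the graph at [A] and at [B]; the weighted
    mean of these two inequalities is the claim. *)
Lemma expR_convex (k A B : R) : 0 <= k -> k <= 1 ->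
  expR (k * A + (1 - k) * B) <= k * expR A + (1 - k) * expR B.
Proof.
move=> k0 k1; set M := k * A + _.
have e C : expR M * (1 + (C - M)) <= expR C.
  by rewrite -[in leRHS](subrKC M C) (expRD M) ler_pM2l ?expR_gt0// expR_ge1Dx.
have -> : expR M = k * (expR M * (1 + (A - M))) + (1 - k) * (expR M * (1 + (B - M))).
  by rewrite /M; ring.
by apply: lerD; apply: ler_wpM2l => //; rewrite subr_ge0.
Qed.

Definition lnGamma x : R := ln (Gamma x).

Lemma expR_lnGamma x : 0 < x -> expR (lnGamma x) = Gamma x.
Proof. by move=> x0; rewrite lnK// posrE Gamma_gt0. Qed.

Lemma lnGammaS x : 0 < x -> lnGamma (x + 1) = ln x + lnGamma x.
Proof. by move=> x0; rewrite /lnGamma GammaS// lnM ?posrE// Gamma_gt0. Qed.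

(** A pointwise Young inequality, which takes the place of Hölder: convexity of [expR] at the points
    [- X + (x - 1) ln t] and [- Y + (y - 1) ln t]. The parameters [X] and [Y] are later the
    logarithms of the two Gamma values. *)
Lemma Gamma_integrand_interpolation (k x y X Y t : R) :
  0 <= k -> k <= 1 -> 0 < t ->
  Gamma_integrand (k * x + (1 - k) * y) t <=
    expR (k * X + (1 - k) * Y) * k * expR (- X) * Gamma_integrand x t
    + expR (k * X + (1 - k) * Y) * (1 - k) * expR (- Y) * Gamma_integrand y t.
Proof.
move=> k0 k1 t0; rewrite /Gamma_integrand !mulrA -mulrDl.
apply: ler_wpM2r; first exact: expR_ge0.
rewrite /powR gt_eqF//; set C := k * X + _; set u := ln t.
have -> : (k * x + (1 - k) * y - 1) * u = C + (k * (- X + (x - 1) * u)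
    + (1 - k) * (- Y + (y - 1) * u)) by rewrite /C; ring.
rewrite (expRD C) -!mulrA -mulrDr ler_pM2l ?expR_gt0//.
by rewrite -!expRD expR_convex.
Qed.

(* [C * k * expR (- X)] and [C * (1 - k) * expR (- Y)] are the weights that make
   the two integrals on the right add up to [C]. *)
Lemma eGamma_interpolation (k x y X Y : R) : 0 <= k -> k <= 1 ->
  eGamma x = (expR X)%:E -> eGamma y = (expR Y)%:E ->
  (eGamma (k * x + (1 - k) * y)%R <= (expR (k * X + (1 - k) * Y))%:E)%E.
Proof.
move=> k0 k1 hx hy; set C := expR _.
have C0 : 0 <= C by exact: expR_ge0.
pose p := C * k * expR (- X); pose q := C * (1 - k) * expR (- Y).
have p0 : 0 <= p by rewrite !mulr_ge0// expR_ge0.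
have q0 : 0 <= q by rewrite !mulr_ge0// ?subr_ge0// expR_ge0.
have m w (D : set R) : measurable_fun D (@Gamma_integrand R w).
  by apply/measurable_EFinP; exact: measurable_Gamma_integrand.
have mk j w (D : set R) :
    measurable_fun D (fun t => (j * Gamma_integrand w t)%:E).
  by apply/measurable_EFinP; exact: measurable_funM.
have g0 w t : 0 <= Gamma_integrand w t by exact: Gamma_integrand_ge0.
have gk (j w t : R) : 0 <= j -> (0 <= (j * Gamma_integrand w t)%:E)%E.
  by move=> j0; rewrite lee_fin mulr_ge0.
have Z (j w : R) : 0 <= j -> (\int[mu]_(t in `]0%R, +oo[)
    (j * Gamma_integrand w t)%:E = j%:E * eGamma w)%E.
  by move=> j0; apply: ge0_integralZl_EFinM => //; exact: m.
have -> : C%:E = (\int[mu]_(t in `]0%R, +oo[)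
    ((p * Gamma_integrand x t)%:E + (q * Gamma_integrand y t)%:E))%E.
  transitivity (p%:E * eGamma x + q%:E * eGamma y)%E.
    rewrite hx hy -!EFinM -EFinD -!mulrA -!expRD !addNr expR0; congr EFin; ring.
  rewrite -!Z//; apply/esym/ge0_integralD => //.
  - by move=> t _; exact: gk.
  - exact: mk.
  - by move=> t _; exact: gk.
  - exact: mk.
apply: ge0_le_integral => //.
- by move=> t _; rewrite lee_fin.
- exact: measurable_Gamma_integrand.
- by apply: emeasurable_funD; exact: mk.
move=> t /=; rewrite in_itv/= andbT => t0.
by rewrite -EFinD lee_fin; exact: Gamma_integrand_interpolation.
Qed.

Lemma lnGamma_convex (k x y : R) : 0 <= k -> k <= 1 -> 0 < x -> 0 < y ->
  lnGamma (k * x + (1 - k) * y) <= k * lnGamma x + (1 - k) * lnGamma y.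
Proof.
move=> k0 k1 x0 y0.
have z0 : 0 < k * x + (1 - k) * y.
  have [->|kn0] := eqVneq k 0; first by rewrite mul0r add0r subr0 mul1r.
  apply: ltr_pwDl; first by rewrite mulr_gt0// lt_def kn0.
  by apply: mulr_ge0; [rewrite subr_ge0|exact: ltW].
rewrite -ler_expR expR_lnGamma// -lee_fin -eGammaE//.
by apply: eGamma_interpolation => //; rewrite eGammaE// expR_lnGamma.
Qed.

Lemma lnGamma_addn x n : 0 < x ->
  lnGamma (x + n%:R) = lnGamma x + \sum_(i < n) ln (x + i%:R).
Proof.
move=> x0; elim: n => [|n IH]; first by rewrite big_ord0 !addr0.
rewrite big_ord_recr/= addrA -IH -natr1 addrA lnGammaS ?ltr_wpDr//.
exact: addrC.
Qed.

(** By convexity the slope over [[z, z + h]] is at least the slope over [[z - 1, z]], which the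
    functional equation evaluates as [ln (z - 1)]. The weight [h / (1 + h)] writes [z] as a mean of
    [z - 1] and [z + h]. *)
Lemma lnGamma_slope_ge z h : 1 < z -> 0 < h ->
  h * ln (z - 1) <= lnGamma (z + h) - lnGamma z.
Proof.
move=> z1 h0.
have z10 : 0 < z - 1 by rewrite subr_gt0.
have h1 : 0 < 1 + h by rewrite addr_gt0.
have k0 : 0 <= h / (1 + h) by rewrite divr_ge0 ?ltW.
have k1 : h / (1 + h) <= 1 by rewrite ler_pdivrMr// mul1r lerDr.
have zh0 : 0 < z + h by rewrite addr_gt0// (lt_trans _ z1).
have := lnGamma_convex k0 k1 z10 zh0.
have -> : h / (1 + h) * (z - 1) + (1 - h / (1 + h)) * (z + h) = z.
  by field; rewrite gt_eqF.
have := lnGammaS z10; rewrite subrK => ->.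
rewrite -(ler_pM2l h1).
set a := ln _; set u := lnGamma _; set v := lnGamma _.
have -> : (1 + h) * (h / (1 + h) * u + (1 - h / (1 + h)) * v) = h * u + v.
  by field; rewrite gt_eqF.
lra.
Qed.

(** By convexity the slope over [[z, z + h]] is at most the slope over [[z, z + n]]; the latter is
    the average of the [ln (z + i)] for [i < n], each at most [ln (z + n)]. *)
Lemma lnGamma_slope_le z h n : 0 < z -> 0 < h -> h <= n%:R ->
  lnGamma (z + h) - lnGamma z <= h * ln (z + n%:R).
Proof.
move=> z0 h0 hn.
have n0 : 0 < n%:R :> R by exact: lt_le_trans hn.
have k0 : 0 <= h / n%:R by rewrite divr_ge0 ?ltW.
have k1 : h / n%:R <= 1 by rewrite ler_pdivrMr// mul1r.
have zn0 : 0 < z + n%:R by rewrite addr_gt0.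
have := lnGamma_convex k0 k1 zn0 z0.
have -> : h / n%:R * (z + n%:R) + (1 - h / n%:R) * z = z + h.
  by field; rewrite gt_eqF.
rewrite lnGamma_addn//.
have : \sum_(i < n) ln (z + i%:R) <= n%:R * ln (z + n%:R).
  apply: (@le_trans _ _ (\sum_(i < n) ln (z + n%:R))); last first.
    by rewrite sumr_const card_ord mulr_natl.
  apply: ler_sum => i _; rewrite ler_ln ?posrE// ?ltr_wpDr//.
  by rewrite lerD2l ler_nat ltnW.
set S := \sum_(i < n) _ => hS hc.
rewrite lerBlDr (le_trans hc)//.
have -> : h / n%:R * (lnGamma z + S) + (1 - h / n%:R) * lnGamma z
  = h / n%:R * S + lnGamma z by ring.
rewrite lerD2r -mulrA ler_pM2l// mulrC ler_pdivrMr//.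
by rewrite mulrC.
Qed.

End log_gamma.

(** * Difference quotients and limits obtained by bracketing *)

Lemma is_derive1_quotientP (R : realType) (f : R -> R) (x df : R) :
  is_derive x 1 f df <-> (f (x + h) - f x) / h @[h --> 0^'] --> df.
Proof.
have -> : (fun h : R => (f (x + h) - f x) / h) =
    (fun h : R => h^-1 *: ((f \o shift x) (h *: (1 : R)) - f x)).
  by apply/funext => h; rewrite /= /GRing.scale/= mulr1 mulrC [h + x]addrC.
split=> [[dfx <-]|fdf]; first exact: dfx.
by apply: DeriveDef; [apply/cvg_ex; exists df|apply/cvg_lim].
Qed.

(** The neighbourhood on which [H] is bracketed may depend on [n] and [e], so a plain squeeze does
    not apply. Two brackets always hold at a common point, whence every [l m] is below every [u n],
    and the supremum of [l] is the common limit. *)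
Lemma cvg_bracketed (R : realType) (F : set_system R) (H : R -> R)
    (l u : nat -> R) : ProperFilter F ->
  (forall n e, 0 < e -> \forall h \near F, l n - e <= H h <= u n + e) ->
  u n - l n @[n --> \oo] --> (0 : R) ->
  exists L : R, H h @[h --> F] --> L /\ l n @[n --> \oo] --> L.
Proof.
move=> FF lHu ul0.
have lu m n : l m <= u n.
  apply/ler_addgt0Pl => e e0.
  have e20 : 0 < e / 2 by rewrite divr_gt0.
  have [h [/andP[h1 _] /andP[_ h2]]] :=
    filter_ex (filterI (lHu m _ e20) (lHu n _ e20)).
  have := le_trans h1 h2; rewrite lerBlDr -addrA -splitr addrC; exact.
have sl : has_sup (range l).
  by split; [exists (l 0%N), 0%N|exists (u 0%N) => _ [n _ <-]].
have lL n : l n <= sup (range l) by apply: sup_upper_bound => //; exists n.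
have Lu n : sup (range l) <= u n by apply: ge_sup; [case: sl|move=> _ [m _ <-]].
exists (sup (range l)); split.
  apply/cvgrPdist_le => e e0.
  have e20 : 0 < e / 2 by rewrite divr_gt0.
  move/cvgrPdist_le : ul0 => /(_ _ e20)[n _ /(_ n (leqnn n))].
  rewrite sub0r normrN => hn.
  near=> h.
  have /andP[h1 h2] : l n - e / 2 <= H h <= u n + e / 2 by near: h; exact: lHu.
  have := lL n; have := Lu n; move: hn; rewrite ler_norml => /andP[_ hn] h3 h4.
  rewrite ler_norml; apply/andP; split; lra.
apply/cvgrPdist_le => e e0.
move/cvgrPdist_le : ul0 => /(_ _ e0); apply: filterS => n.
rewrite sub0r normrN => hn.
have := lL n; have := Lu n; move: hn; rewrite ler_norml => /andP[_ hn] h3 h4.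
by rewrite ger0_norm; lra.
Unshelve. all: by end_near. Qed.

Lemma cvgn_invn (R : realType) : (n%:R : R)^-1 @[n --> \oo] --> (0 : R).
Proof. by have := @cvg_harmonic R; rewrite -(@cvg_shiftS _ (fun n => (n%:R : R)^-1)). Qed.

Lemma cvg_ln_shift (R : realType) (z : R) :
  ln (n%:R + z) - ln n%:R @[n --> \oo] --> (0 : R).
Proof.
have c1 : 1 + z * (n%:R : R)^-1 @[n --> \oo] --> (1 : R).
  rewrite -[X in _ --> X]addr0; apply: cvgD; first exact: cvg_cst.
  by rewrite -[X in _ --> X](mulr0 z); apply: cvgMr; exact: cvgn_invn.
have h : ln (1 + z * (n%:R : R)^-1) @[n --> \oo] --> (0 : R).
  rewrite -[X in _ --> X](@ln1 R).
  exact: (cvg_comp _ _ c1 (continuous_ln ltr01)).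
apply: cvg_trans h; apply: near_eq_cvg; near=> n.
have n0 : 0 < n%:R :> R by near: n; exists 1%N => // n /=; rewrite ltr0n.
have nz : 0 < n%:R + z.
  rewrite -ltrBlDr sub0r; near: n; exact: nbhs_infty_gtr.
rewrite -ln_div ?posrE//; congr ln.
by field; rewrite gt_eqF.
Unshelve. all: by end_near. Qed.

(** * Differentiability of [ln Gamma] and the limit formula for digamma *)

Section digamma.
Variable R : realType.
Implicit Types x y h : R.

Lemma is_derive_ln_shift x k : 0 < x + k -> is_derive x 1 (fun y => ln (y + k)) (x + k)^-1.
Proof.
move=> xk.
have d := @is_derive1_comp R (@ln R) (shift k) x _ _ (is_derive1_ln xk)
  (is_derive_shift x 1 k).
by rewrite mulr1 in d.
Qed.

Lemma is_derive_sum_ln x n : 0 < x ->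
  is_derive x 1 (fun y => \sum_(i < n) ln (y + i%:R)) (\sum_(i < n) (x + i%:R)^-1).
Proof.
move=> x0.
have -> : (fun y : R => \sum_(i < n) ln (y + i%:R)) = \sum_(i < n) (fun y : R => ln (y + i%:R)).
  by apply/funext => y; rewrite fct_sumE.
by apply: is_derive_sum => i; apply: is_derive_ln_shift; rewrite ltr_wpDr.
Qed.

(** For [h < 0] the slope bounds are applied at the base point [z + h] with step [- h]. The ends
    [z - 2] and [z + 1] are loose enough to serve both signs of [h]. *)
Lemma lnGamma_quotient z h : 2 < z -> h != 0 -> `|h| < 1 ->
  ln (z - 2) <= (lnGamma (z + h) - lnGamma z) / h <= ln (z + 1).
Proof.
move=> z2 hn0 h1; have [h0|h0|h0] := ltgtP h 0; last by rewrite h0 eqxx in hn0.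
  have hh1 : - h < 1 by rewrite -(ltr0_norm h0).
  have z1 : 1 < z + h by lra.
  have z20 : 0 < z - 2 by lra.
  have zh : z - 2 <= z + h - 1 by lra.
  have zh0 : 0 < z + h + 1 by lra.
  have zh1 : z + h + 1 <= z + 1 by lra.
  have nh0 : 0 < - h by rewrite oppr_gt0.
  have := lnGamma_slope_ge z1 nh0; have := @lnGamma_slope_le R (z + h) (- h) 1.
  rewrite addrK => /(_ (lt_trans ltr01 z1) nh0 (ltW hh1)) ub lb.
  rewrite -[_ / h]mulrNN -invrN opprB ler_pdivlMr// ler_pdivrMr//.
  apply/andP; split.
    apply: le_trans lb; rewrite mulrC ler_pM2l// ler_ln// posrE.
      exact: lt_le_trans zh.
  by apply: (le_trans ub); rewrite mulrC ler_pM2r// ler_ln// posrE (lt_le_trans zh0).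
rewrite (gtr0_norm h0) in h1.
rewrite ler_pdivlMr// ler_pdivrMr//; apply/andP; split.
  apply: le_trans (lnGamma_slope_ge _ h0); last by lra.
  by rewrite mulrC ler_pM2l// ler_ln ?posrE; lra.
by rewrite mulrC; apply: (@lnGamma_slope_le R z h 1) => //; lra.
Qed.

(** The quotient at [x] is the quotient at [x + n + 2] minus that of a finite sum of logarithms,
    whose derivative is known. The former lies between [ln (n + x)] and [ln (n + x + 3)], and the
    gap between these tends to 0. Shifting by [n + 2] puts the base point above 2 for every [n]. *)
Lemma lnGamma_derive x : 0 < x -> exists L : R, is_derive x 1 (@lnGamma R) L /\
  ln (n%:R + x) - \sum_(i < n.+2) (x + i%:R)^-1 @[n --> \oo] --> L.
Proof.
move=> x0.
pose S n := \sum_(i < n.+2) (x + i%:R)^-1.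
have [n e e0||L [hL lL]] := @cvg_bracketed R (0^') (fun h => (lnGamma (x + h) - lnGamma x) / h)
  (fun n => ln (n%:R + x) - S n) (fun n => ln (n%:R + (x + 3)) - S n).
- have /is_derive1_quotientP/cvgrPdist_le/(_ e e0) hS := is_derive_sum_ln n.+2 x0.
  near=> h.
  have hn0 : h != 0 by near: h; exact: nbhs_dnbhs_neq.
  have h1 : `|h| < 1 by near: h; exact: dnbhs0_lt.
  have hx : `|h| < x by near: h; exact: dnbhs0_lt.
  have xh0 : 0 < x + h by move: hx; rewrite ltr_norml => /andP[]; lra.
  have : `|S n - (\sum_(i < n.+2) ln (x + h + i%:R) - \sum_(i < n.+2) ln (x + i%:R)) / h| <= e.
    by near: h.
  have n2 : n.+2%:R = n%:R + 2 :> R by rewrite -[n.+2]addn2 natrD.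
  have z2 : 2 < x + n.+2%:R by rewrite n2; have := ler0n R n; lra.
  have := lnGamma_quotient z2 hn0 h1.
  rewrite (addrAC x _ h) !lnGamma_addn//.
  set A := \sum_(i < n.+2) ln (x + h + i%:R).
  set B := \sum_(i < n.+2) ln (x + i%:R).
  move: (lnGamma (x + h)) (lnGamma x) => u v.
  have -> : u + A - (v + B) = (u - v) + (A - B) by ring.
  rewrite mulrDl; set D := _ / h; set E := _ / h.
  have -> : x + n.+2%:R - 2 = n%:R + x by rewrite n2; ring.
  have -> : x + n.+2%:R + 1 = n%:R + (x + 3) by rewrite n2; ring.
  move=> /andP[p1 p2]; rewrite ler_norml => /andP[p3 p4].
  by apply/andP; split; lra.
- have -> : (fun n : nat => ln (n%:R + (x + 3)) - S n - (ln (n%:R + x) - S n)) =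
      (fun n : nat => (ln (n%:R + (x + 3)) - ln n%:R) - (ln (n%:R + x) - ln n%:R)).
    by apply/funext => n; ring.
  by rewrite -[X in _ --> X]subr0; apply: cvgB; exact: cvg_ln_shift.
by exists L; split => //; apply/is_derive1_quotientP.
Unshelve. all: by end_near. Qed.

Lemma cvg_digamma x : 0 < x ->
  ln n%:R - \sum_(i < n) (x + i%:R)^-1 @[n --> \oo] --> digamma x.
Proof.
move=> x0; have [L [dL lL]] := lnGamma_derive x0.
have -> : digamma x = L.
  (* Near [x], [Gamma] is the exponential of [lnGamma], so its derivative is [Gamma x * L]. *)
  have e : \forall y \near x, Gamma y = (expR \o @lnGamma R) y.
    near=> y; rewrite /= expR_lnGamma//; near: y; exact: lt_nbhsr.
  have := is_derive1_comp (is_derive_expR (lnGamma x)) dL => -[_ d].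
  rewrite /digamma derive1E (near_eq_derive _ e) d expR_lnGamma//.
  by rewrite mulrAC divff ?mul1r// gt_eqF// Gamma_gt0.
rewrite -(cvg_shiftn 2).
have -> : (fun n => ln (n + 2)%:R - \sum_(i < n + 2) (x + i%:R)^-1) =
  (fun n : nat => (ln (n%:R + x) - \sum_(i < n.+2) (x + i%:R)^-1) +
     ((ln (n%:R + 2) - ln n%:R) - (ln (n%:R + x) - ln n%:R))).
  by apply/funext => n; rewrite natrD addn2; ring.
rewrite -(addr0 L); apply: cvgD; first exact: lL.
by rewrite -[X in _ --> X](subr0 (0 : R)); apply: cvgB; exact: cvg_ln_shift.
Unshelve. all: by end_near. Qed.

(** The two slope bounds at [x + n] with step [y - x] squeeze the quotient between logarithms of
    fixed shifts of [n]. The quotient is symmetric in [x] and [y], so [x < y] may be assumed. *)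
Lemma cvg_lnGamma_slope x y : 0 < x -> 0 < y -> x != y ->
  (lnGamma (y + n%:R) - lnGamma (x + n%:R)) / (y - x) - ln n%:R @[n --> \oo] --> (0 : R).
Proof.
wlog xy : x y / x < y.
  move=> W x0 y0; rewrite neq_lt => /orP[xy|yx]; first by apply: W; rewrite // lt_eqF.
  have := W y x yx y0 x0; rewrite lt_eqF// => /(_ isT).
  apply: cvg_trans; apply: near_eq_cvg; apply: nearW => n.
  move: (lnGamma (x + n%:R)) (lnGamma (y + n%:R)) => u v.
  by rewrite -(opprB v u) -(opprB y x) invrN mulrNN.
move=> x0 y0 _; pose k := (Num.truncn (y - x)).+1.
have h0 : 0 < y - x by rewrite subr_gt0.
have hk : y - x <= k%:R by exact/ltW/truncnS_gt.
apply: (@squeeze_cvgr _ _ _ _ (fun n => ln (n%:R + (x - 1)) - ln n%:R)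
  (fun n => ln (n%:R + (x + k%:R)) - ln n%:R)); [|exact: cvg_ln_shift..].
exists 1%N => // n /= n1.
have xn1 : 1 < x + n%:R by rewrite ltr_pwDl// ler1n.
have := lnGamma_slope_ge xn1 h0.
have := lnGamma_slope_le (lt_trans ltr01 xn1) h0 hk.
have -> : x + n%:R + (y - x) = y + n%:R by ring.
have -> : x + n%:R + k%:R = n%:R + (x + k%:R) by ring.
have -> : x + n%:R - 1 = n%:R + (x - 1) by ring.
move=> ub lb; apply/andP; split.
  by rewrite lerD2r ler_pdivlMr// mulrC.
by rewrite lerD2r ler_pdivrMr// mulrC.
Qed.

End digamma.

(** * Summation of the series *)

Section series.
Variable R : realType.
Implicit Types a b c d : R.

(** The series starts at index 1; moving the start to 0 is what produces the arguments [(b + d) / b]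
    of the closed form. *)
Lemma arith_shift b d (i : nat) : b != 0 -> b * i.+1%:R + d = b * ((b + d) / b + i%:R).
Proof. by move=> b0; rewrite -natr1; field. Qed.

Lemma sum_invr_arith b d n : b != 0 ->
  \sum_(1 <= i < n.+1) (b * i%:R + d)^-1 = b^-1 * \sum_(i < n) ((b + d) / b + i%:R)^-1.
Proof.
move=> b0; rewrite big_add1/= big_mkord mulr_sumr; apply: eq_bigr => i _.
by rewrite arith_shift// invfM.
Qed.

(** Each argument of [ln] is the quotient of [b i + c] by [b i + a], so the sum is a difference of
    two sums of logarithms, both given by the functional equation. *)
Lemma sum_ln_arith a b c n : 0 < b -> 0 < a + b -> 0 < c + b ->
  \sum_(1 <= i < n.+1) ln (1 + (c - a) / (b * i%:R + a)) =
  (lnGamma ((b + c) / b + n%:R) - lnGamma ((b + a) / b + n%:R))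
  - (lnGamma ((b + c) / b) - lnGamma ((b + a) / b)).
Proof.
move=> b0 ab cb.
have bn0 : b != 0 by rewrite gt_eqF.
have p e : 0 < e + b -> 0 < (b + e) / b by move=> eb; rewrite divr_gt0// addrC.
rewrite !lnGamma_addn ?p//.
move: (lnGamma ((b + c) / b)) (lnGamma ((b + a) / b)) => u v.
set A := \sum_(i < n) _; set B := \sum_(i < n) _.
have -> : u + A - (v + B) - (u - v) = A - B by ring.
rewrite -sumrB big_add1/= big_mkord; apply: eq_bigr => i _.
have pi e : 0 < e + b -> 0 < (b + e) / b + i%:R by move=> eb; rewrite ltr_wpDr// p.
rewrite -ln_div ?posrE ?pi//; congr ln.
rewrite arith_shift//; have := pi _ ab; have := pi _ cb => h1 h2.
have h3 : b + a + i%:R * b != 0.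
  rewrite gt_eqF// (_ : _ + _ = b * ((b + a) / b + i%:R)) ?mulr_gt0//.
  by field.
by field; rewrite bn0.
Qed.

Lemma cvg_sum_invrB b d e : 0 < b -> 0 < d + b -> 0 < e + b ->
  \sum_(1 <= i < n) ((b * i%:R + d)^-1 - (b * i%:R + e)^-1) @[n --> \oo] -->
  (digamma ((b + e) / b) - digamma ((b + d) / b)) / b.
Proof.
move=> b0 db eb; rewrite -cvg_shiftS.
have p x : 0 < x + b -> 0 < (b + x) / b by move=> xb; rewrite divr_gt0// addrC.
have bn0 : b != 0 by rewrite gt_eqF.
under eq_fun do rewrite sumrB !sum_invr_arith//.
have -> : (fun n : nat => b^-1 * \sum_(i < n) ((b + d) / b + i%:R)^-1
    - b^-1 * \sum_(i < n) ((b + e) / b + i%:R)^-1) =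
  (fun n : nat => ((ln n%:R - \sum_(i < n) ((b + e) / b + i%:R)^-1)
    - (ln n%:R - \sum_(i < n) ((b + d) / b + i%:R)^-1)) * b^-1).
  by apply/funext => n; ring.
by apply: cvgM; [apply: cvgB; exact/cvg_digamma/p|exact: cvg_cst].
Qed.

(** The sum of reciprocals and the slope of [lnGamma] both grow like [ln n / b]. Inserting [ln n] in
    each separates a sequence tending to digamma from one tending to 0. *)
Lemma cvg_sum_term36 a b c d :
  0 < b -> 0 < a + b -> 0 < c + b -> 0 < d + b -> c != a ->
  \sum_(1 <= i < n) term36 a b c d i @[n --> \oo] --> closed36 a b c d.
Proof.
move=> b0 ab cb db ca; rewrite -cvg_shiftS.
have p x : 0 < x + b -> 0 < (b + x) / b by move=> xb; rewrite divr_gt0// addrC.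
have bn0 : b != 0 by rewrite gt_eqF.
have can0 : c - a != 0 by rewrite subr_eq0.
have XaXc : (b + a) / b != (b + c) / b.
  by rewrite eq_sym -subr_eq0 -mulrBl mulf_neq0 ?invr_neq0// opprD addrACA subrr add0r.
pose la := lnGamma ((b + a) / b); pose lc := lnGamma ((b + c) / b).
have -> : (fun n : nat => \sum_(1 <= i < n.+1) term36 a b c d i) =
  (fun n : nat => (lc - la) / (c - a)
   - ((ln n%:R - \sum_(i < n) ((b + d) / b + i%:R)^-1)
     + ((lnGamma ((b + c) / b + n%:R) - lnGamma ((b + a) / b + n%:R))
         / ((b + c) / b - (b + a) / b) - ln n%:R)) / b).
  apply/funext => n; rewrite /term36 sumrB -mulr_suml sum_ln_arith// -/la -/lc.
  under eq_bigr do rewrite div1r.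
  rewrite sum_invr_arith//.
  have -> : (b + c) / b - (b + a) / b = (c - a) / b by ring.
  move: (lnGamma _) (lnGamma _) la lc => u v r s.
  move: (\sum_(i < n) _) => S.
  by field; rewrite ?can0 ?bn0.
have -> : closed36 a b c d = (lc - la) / (c - a) - (digamma ((b + d) / b) + 0) / b.
  by rewrite /closed36 ln_div ?posrE ?Gamma_gt0 ?[a + b]addrC ?p// addr0.
apply: cvgB; first exact: cvg_cst.
apply: cvgM; last exact: cvg_cst.
apply: cvgD; first exact/cvg_digamma/p.
by apply: cvg_lnGamma_slope => //; exact: p.
Qed.

End series.

(** * The logarithmic kernel and its integral over the unit square *)

Lemma ge0_integral_swap d1 d2 (T1 : measurableType d1) (T2 : measurableType d2)
    (R : realType) (m1 : {sigma_finite_measure set T1 -> \bar R})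
    (m2 : {sigma_finite_measure set T2 -> \bar R}) (A : set T1) (B : set T2)
    (f : T1 * T2 -> R) : measurable A -> measurable B ->
  measurable_fun (A `*` B) f -> (forall z, (A `*` B) z -> 0 <= f z) ->
  (\int[m1]_(x in A) \int[m2]_(y in B) (f (x, y))%:E =
   \int[m2]_(y in B) \int[m1]_(x in A) (f (x, y))%:E)%E.
Proof.
move=> mA mB mf f0.
have [e1 e2] := @ge0_tonelli_setX _ _ _ _ R m1 m2 A B (EFin \o f) mA mB
  ((measurable_EFinP _ _).2 mf) f0.
by rewrite -e1 e2.
Qed.

Section log_kernel.
Variable R : realType.
Notation mu := (@lebesgue_measure R).
Implicit Types p q x y s : R.

(** Inversion is the power of exponent -1 on the nonnegative reals, the value 0 at 0 included, and
    it is odd. *)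
Lemma measurable_invr : measurable_fun [set: R] (fun x : R => x^-1).
Proof.
have -> : (fun x : R => x^-1) = (fun x => if x < 0 then - (- x) `^ (-1) else x `^ (-1)).
  apply/funext => x; case: ifPn => [x0|]; last by rewrite -leNgt => /powR_inv1.
  by rewrite powR_inv1 ?invrN ?opprK// oppr_ge0 ltW.
apply: measurable_fun_ifT => //; first exact: measurable_fun_ltr.
apply: measurableT_comp => //.
exact: (measurableT_comp (measurable_powR (-1))).
Qed.

Lemma measurable_funV d (T : measurableType d) (D : set T) (f : T -> R) :
  measurable_fun D f -> measurable_fun D (fun t => (f t)^-1).
Proof. exact: (measurableT_comp measurable_invr). Qed.

Lemma measurable_fun_powR d (T : measurableType d) (D : set T) (f : T -> R) r :
  measurable_fun D f -> measurable_fun D (fun t => f t `^ r).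
Proof. exact: (measurableT_comp (measurable_powR r)). Qed.

Lemma measurable_fun_ln d (T : measurableType d) (D : set T) (f : T -> R) :
  measurable_fun D f -> measurable_fun D (fun t => ln (f t)).
Proof. exact: (measurableT_comp (@measurable_ln R)). Qed.

(** Open, so that [0 < x y < 1] throughout and no logarithm of 0 or 1 occurs; the edges are restored
    at the end as a null set. *)
Definition unit_square : set (R * R) := `]0, 1[%classic `*` `]0, 1[%classic.

Lemma measurable_unit_square : measurable unit_square.
Proof. exact: measurableX. Qed.

Lemma unit_squareP (z : R * R) : unit_square z ->
  [/\ 0 < z.1, z.1 < 1, 0 < z.2, z.2 < 1 & 0 < z.1 * z.2 < 1].
Proof.
case: z => x y [/=]; rewrite !in_itv/= => /andP[x0 x1] /andP[y0 y1].
by split => //; rewrite mulr_gt0//= mulr_ilt1// ltW.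
Qed.

(** The integrand is the sum over [n >= 1] of the kernel with both exponents [b n + d] minus the
    kernel with exponents [b n + a] and [b n + c]. *)
Definition log_kernel p q (z : R * R) : R :=
  z.1 `^ (p - 1) * z.2 `^ (q - 1) / - ln (z.1 * z.2).

Lemma measurable_log_kernel p q (D : set (R * R)) : measurable_fun D (log_kernel p q).
Proof.
apply: measurable_funTS; apply: measurable_funM.
  apply: measurable_funM; apply: measurable_fun_powR;
    [exact: measurable_fst|exact: measurable_snd].
apply: measurable_funV; apply: measurableT_comp => //.
apply: measurable_fun_ln; apply: measurable_funM;
  [exact: measurable_fst|exact: measurable_snd].
Qed.

Lemma log_kernel_ge0 p q z : unit_square z -> 0 <= log_kernel p q z.
Proof.
move=> /unit_squareP[x0 x1 y0 y1 xy].
by rewrite divr_ge0 ?mulr_ge0 ?powR_ge0// oppr_ge0 ltW// ln_lt0.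
Qed.

(** For [x > 0] this is [x^(p + s - 1)], in a form whose joint measurability in [(x, s)] is
    immediate. *)
Definition expker p x s := x `^ (p - 1) * expR (s * ln x).

Lemma expker_ge0 p x s : 0 <= expker p x s.
Proof. by rewrite mulr_ge0 ?powR_ge0 ?expR_ge0. Qed.

Lemma measurable_expker p (D : set (R * R)) :
  measurable_fun D (fun z => expker p z.1 z.2).
Proof.
apply: measurable_funTS; apply: measurable_funM.
  apply: measurable_fun_powR; exact: measurable_fst.
apply: measurableT_comp => //; apply: measurable_funM; first exact: measurable_snd.
apply: measurable_fun_ln; exact: measurable_fst.
Qed.

Lemma integral_expker p s : 0 < p -> 0 <= s ->
  (\int[mu]_(x in `]0%R, 1%R[) (expker p x s)%:E = (p + s)^-1%:E)%E.
Proof.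
move=> p0 s0; have ps : 0 < p + s by rewrite ltr_wpDr.
transitivity (\int[mu]_(x in `]0%R, 1%R[) (x `^ (p + s - 1))%:E)%E.
  apply: eq_integral => x; rewrite inE/= in_itv/= => /andP[x0 _]; congr EFin.
  rewrite /expker addrAC [RHS]powRD; last by rewrite (gt_eqF x0) implybT.
  by congr (_ * _); rewrite /powR gt_eqF.
by rewrite integral_powR// powR1 div1r.
Qed.

(* [1 / - ln (x y)] is the integral of [(x y)^s] over [s >= 0]. *)
Lemma log_kernelE p q z : unit_square z ->
  ((log_kernel p q z)%:E =
   \int[mu]_(s in `[0%R, +oo[) (expker p z.1 s * expker q z.2 s)%:E)%E.
Proof.
move=> /unit_squareP[x0 x1 y0 y1 xy].
have k0 : 0 < - ln (z.1 * z.2) by rewrite oppr_gt0 ln_lt0.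
transitivity (\int[mu]_(s in `[0%R, +oo[)
    (z.1 `^ (p - 1) * z.2 `^ (q - 1) * expR (- (- ln (z.1 * z.2) * s)))%:E)%E.
  rewrite ge0_integralZl_EFinM//.
  - by rewrite integral_expR_ray// mulr0 oppr0 expR0 div1r -EFinM.
  - apply: measurable_funTS; apply: measurableT_comp => //.
    by apply: measurableT_comp => //; exact: measurable_funM.
  - by rewrite mulr_ge0 ?powR_ge0.
apply: eq_integral => s _; congr EFin; rewrite /expker.
rewrite mulrACA -expRD; congr (_ * expR _).
by rewrite lnM ?posrE//; ring.
Qed.

(** The integral over [s] is moved outward, first past [x] and then past [y]; the two inner
    integrals give the factors [1 / (p + s)] and [1 / (q + s)]. *)
Lemma integral_log_kernel p q : 0 < p -> 0 < q ->
  (\int[mu \x mu]_(z in unit_square) (log_kernel p q z)%:E =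
   \int[mu]_(s in `[0%R, +oo[) ((p + s)^-1 * (q + s)^-1)%:E)%E.
Proof.
move=> p0 q0.
have ms r x (D : set R) : measurable_fun D (expker r x).
  apply: measurable_funTS; apply: measurable_funM => //.
  by apply: measurableT_comp => //; exact: measurable_funM.
have mx r s (D : set R) : measurable_fun D (expker r ^~ s).
  apply: measurable_funTS; apply: measurable_funM => //.
  by apply: measurableT_comp => //; exact: measurable_funM.
have mV r (D : set R) : measurable_fun D (fun s : R => (r + s)^-1).
  by apply: measurable_funTS; apply: measurable_funV; exact: measurable_funD.
have pV r s : 0 < r -> 0 <= s -> 0 <= (r + s)^-1.
  by move=> r0 s0; rewrite invr_ge0 addr_ge0// ltW.
rewrite /unit_square.
have [_ ->] := @ge0_tonelli_setX _ _ _ _ R mu mu `]0, 1[%classic `]0, 1[%classic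
  (EFin \o log_kernel p q) (measurable_itv _) (measurable_itv _)
  ((measurable_EFinP _ _).2 (@measurable_log_kernel p q _))
  (@log_kernel_ge0 p q).
transitivity (\int[mu]_(y in `]0%R, 1%R[) \int[mu]_(s in `[0%R, +oo[)
    (expker q y s * (p + s)^-1)%:E)%E.
  apply: eq_integral => y; rewrite inE => yI.
  transitivity (\int[mu]_(x in `]0%R, 1%R[) \int[mu]_(s in `[0%R, +oo[)
      (expker p x s * expker q y s)%:E)%E.
    apply: eq_integral => x; rewrite inE => xI.
    by rewrite /comp log_kernelE.
  rewrite (@ge0_integral_swap _ _ _ _ R mu mu _ _
    (fun z => expker p z.1 z.2 * expker q y z.2))//.
  - apply: eq_integral => s; rewrite inE/= in_itv/= andbT => s0.
    under eq_integral do rewrite mulrC.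
    rewrite ge0_integralZl_EFinM ?expker_ge0//; first by rewrite integral_expker.
      exact: mx.
    by move=> x _; exact: expker_ge0.
  - apply: measurable_funM; first exact: measurable_expker.
    apply: measurable_funTS.
    exact: (measurableT_comp (ms q y setT) measurable_snd).
  - by move=> z _; rewrite mulr_ge0 ?expker_ge0.
rewrite (@ge0_integral_swap _ _ _ _ R mu mu _ _
    (fun z => expker q z.1 z.2 * (p + z.2)^-1))//.
- apply: eq_integral => s; rewrite inE/= in_itv/= andbT => s0.
  under eq_integral do rewrite mulrC.
  rewrite ge0_integralZl_EFinM ?pV//; first by rewrite integral_expker.
    exact: mx.
  by move=> x _; exact: expker_ge0.
- apply: measurable_funM; first exact: measurable_expker.
  apply: measurable_funTS.
  exact: (measurableT_comp (mV p setT) measurable_snd).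
- move=> z [_ /=]; rewrite in_itv/= andbT => s0.
  by rewrite mulr_ge0 ?expker_ge0 ?pV.
Qed.

End log_kernel.

Arguments unit_square {R}.

(** * Closed values of the kernel integrals *)

Section kernel_values.
Variable R : realType.
Notation mu := (@lebesgue_measure R).
Implicit Types p q x y s : R.

Lemma cvgy_inv_shift p : (s + p)^-1 @[s --> +oo] --> (0 : R).
Proof.
apply/(@gtr0_cvgV0 _ _ _ _ (fun s : R => s + p)).
  near=> s; rewrite -ltrBlDr sub0r; near: s; exact: (nbhs_pinfty_gt (num_real _)).
apply/cvgryPge => A; near=> s; rewrite -lerBlDr; near: s; exact: (nbhs_pinfty_ge (num_real _)).
Unshelve. all: by end_near. Qed.

Lemma cvgy_ln_shiftB p q : ln (s + p) - ln (s + q) @[s --> +oo] --> (0 : R).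
Proof.
have c1 : 1 + (p - q) * (s + q)^-1 @[s --> +oo] --> (1 : R).
  rewrite -[X in _ --> X]addr0; apply: cvgD; first exact: cvg_cst.
  by rewrite -[X in _ --> X](mulr0 (p - q)); apply: cvgMr; exact: cvgy_inv_shift.
have h : ln (1 + (p - q) * (s + q)^-1) @[s --> +oo] --> (0 : R).
  rewrite -[X in _ --> X](@ln1 R).
  exact: (cvg_comp _ _ c1 (continuous_ln ltr01)).
apply: cvg_trans h; apply: near_eq_cvg; near=> s.
have sp : 0 < s + p by rewrite -ltrBlDr sub0r; near: s; exact: (nbhs_pinfty_gt (num_real _)).
have sq : 0 < s + q by rewrite -ltrBlDr sub0r; near: s; exact: (nbhs_pinfty_gt (num_real _)).
rewrite -ln_div ?posrE//; congr ln.
by field; rewrite gt_eqF.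
Unshelve. all: by end_near. Qed.

Lemma continuous_inv_shift p x : 0 < x + p -> {for x, continuous (fun s : R => (s + p)^-1)}.
Proof.
move=> xp; apply: continuousV; first by rewrite gt_eqF.
by apply: continuousD; [exact: cvg_id|exact: cst_continuous].
Qed.

Lemma continuous_inv_mul p q x : 0 < p -> 0 < q -> 0 <= x ->
  {for x, continuous (fun s : R => (p + s)^-1 * (q + s)^-1)}.
Proof.
move=> p0 q0 x0.
have -> : (fun s : R => (p + s)^-1 * (q + s)^-1) = (fun s : R => (s + p)^-1 * (s + q)^-1).
  by apply/funext => s; rewrite addrC [q + s]addrC.
by apply: continuousM; apply: continuous_inv_shift; rewrite ltr_wpDl.
Qed.

Lemma inv_mul_ge0 p q x : 0 < p -> 0 < q -> 0 <= x -> 0 <= (p + x)^-1 * (q + x)^-1.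
Proof.
by move=> p0 q0 x0; rewrite mulr_ge0// invr_ge0 addr_ge0// ltW.
Qed.

Lemma integral_inv_sqr p : 0 < p ->
  (\int[mu]_(s in `[0%R, +oo[) ((p + s)^-1 * (p + s)^-1)%:E = p^-1%:E)%E.
Proof.
move=> p0.
apply: (eq_trans (@ge0_FTCy _ _ (fun s => - (s + p)^-1) _ 0 _ _ _ _)).
- by move=> x x0; exact: inv_mul_ge0.
- by move=> x x0; exact: continuous_inv_mul.
- move=> x x0; have xp : x + p != 0 by rewrite gt_eqF// ltr_wpDl.
  apply: is_derive_eq.
  rewrite /GRing.scale/= -exprVn [p + x]addrC; ring.
- by rewrite -oppr0; apply: cvgN; exact: cvgy_inv_shift.
- by rewrite !add0r opprK.
Qed.

(** Partial fractions give a difference of two logarithms as antiderivative; each diverges at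
    infinity, but the difference tends to 0. *)
Lemma integral_inv_mul p q : 0 < p -> 0 < q -> p != q ->
  (\int[mu]_(s in `[0%R, +oo[) ((p + s)^-1 * (q + s)^-1)%:E
   = ((ln q - ln p) / (q - p))%:E)%E.
Proof.
move=> p0 q0 pq; have qp : q - p != 0 by rewrite subr_eq0 eq_sym.
apply: (eq_trans (@ge0_FTCy _ _
  (fun s => (q - p)^-1 * (ln (s + p) - ln (s + q))) _ 0 _ _ _ _)).
- by move=> x x0; exact: inv_mul_ge0.
- by move=> x x0; exact: continuous_inv_mul.
- move=> x x0; have xp : 0 < x + p by rewrite ltr_wpDl.
  have xq : 0 < x + q by rewrite ltr_wpDl.
  have dp := is_derive_ln_shift xp; have dq := is_derive_ln_shift xq.
  apply: is_derive_eq.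
  rewrite /GRing.scale/= [p + x]addrC [q + x]addrC.
  by field; rewrite qp !gt_eqF.
- rewrite -[X in _ --> X](mulr0 (q - p)^-1); apply: cvgMr.
  exact: cvgy_ln_shiftB.
- by rewrite !add0r; congr EFin; ring.
Qed.

End kernel_values.

(** * Geometric expansion of the integrand and monotone convergence *)

Section integrand.
Variable R : realType.
Notation mu := (@lebesgue_measure R).
Notation mu2 := (mu \x mu)%E.
Implicit Types a b c d m : R.

Lemma measurable_integrand36 a b c d (D : set (R * R)) :
  measurable_fun D (fun z => integrand36 a b c d z.1 z.2).
Proof.
have m1 : measurable_fun [set: R * R] (fun z => z.1) by exact: measurable_fst.
have m2 : measurable_fun [set: R * R] (fun z => z.2) by exact: measurable_snd.
have m12 : measurable_fun [set: R * R] (fun z => z.1 * z.2) by exact: measurable_funM.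
apply: measurable_funTS; apply: measurable_funM.
  apply: measurable_funM; first exact: measurable_fun_powR.
  apply: measurable_funB; first exact: measurable_fun_powR.
  by apply: measurable_funM; exact: measurable_fun_powR.
apply: measurable_funV; apply: measurable_funM; last exact: measurable_fun_ln.
apply: measurableT_comp => //; apply: measurable_funB => //.
exact: measurable_fun_powR.
Qed.

Lemma ge0_integrable_EFin dd (T : measurableType dd) (nu : {measure set T -> \bar R})
    (D : set T) (f : T -> R) (v : R) :
  measurable_fun D f -> (forall x, D x -> 0 <= f x) ->
  (\int[nu]_(x in D) (f x)%:E = v%:E)%E -> nu.-integrable D (EFin \o f).
Proof.
move=> mf f0 fv; apply/integrableP; split; first exact/measurable_EFinP.
suff -> : (\int[nu]_(x in D) `|(EFin \o f) x| = v%:E)%E by rewrite ltry.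
rewrite -fv; apply: eq_integral => x; rewrite inE => Dx.
by rewrite /= ger0_norm ?f0.
Qed.

Lemma powR_arith (x b r : R) (i : nat) : 0 < x ->
  x `^ (b * i%:R + r - 1) = (x `^ b) ^+ i * x `^ (r - 1).
Proof.
move=> x0; rewrite -addrA [LHS]powRD; last by rewrite (gt_eqF x0) implybT.
by rewrite powRrM powR_mulrn ?powR_ge0.
Qed.

Lemma log_kernel_arith b r r' (i : nat) (z : R * R) : unit_square z ->
  log_kernel (b * i%:R + r) (b * i%:R + r') z =
  ((z.1 * z.2) `^ b) ^+ i * log_kernel r r' z.
Proof.
move=> /unit_squareP[x0 _ y0 _ _].
rewrite /log_kernel !powR_arith// powRM ?ltW// exprMn; ring.
Qed.

(** Powers of a number in []0, 1[] decrease as the exponent grows. *)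
Lemma log_kernel_le a c m (z : R * R) : unit_square z -> m <= a -> m <= c ->
  log_kernel a c z <= log_kernel m m z.
Proof.
move=> /unit_squareP[x0 x1 y0 y1 xy] ma mc.
rewrite /log_kernel ler_wpM2r//.
  by rewrite invr_ge0 oppr_ge0 ltW// ln_lt0.
by apply: ler_pM; rewrite ?powR_ge0//; apply: ger_powR;
  rewrite ?lerD2r// ?x0 ?y0 ltW.
Qed.

Lemma integrand36_log_kernel a b c d (z : R * R) : 0 < b -> unit_square z ->
  integrand36 a b c d z.1 z.2 =
  (z.1 * z.2) `^ b * (log_kernel d d z - log_kernel a c z)
    * (1 - (z.1 * z.2) `^ b)^-1.
Proof.
move=> b0 /unit_squareP[x0 x1 y0 y1 xy].
rewrite /integrand36 /log_kernel -mulrBl -powRM ?ltW//.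
by rewrite mulNr invrN invfM invrN; ring.
Qed.

Lemma powR_lt1 (x b : R) : 0 < x < 1 -> 0 < b -> x `^ b < 1.
Proof.
move=> /andP[x0 x1] b0.
have := @gt0_ltr_powR R b b0 x 1; rewrite powR1; apply => //; last exact: ler01.
exact: ltW.
Qed.

(** With [m] below both [a] and [c], all terms of the expansion are nonnegative: monotone
    convergence gives the integral, and its finiteness gives integrability. The values [J] are left
    abstract because they are logarithmic when [a] and [c] differ and reciprocals when they
    agree. *)
Lemma integral_integrand36_ge0 a b c m (J : nat -> R) (V : R) :
  0 < b -> 0 < m + b -> m <= a -> m <= c ->
  (forall i, \int[mu2]_(z in unit_square)
     (log_kernel (b * i.+1%:R + a) (b * i.+1%:R + c) z)%:E = (J i.+1)%:E)%E ->
  \sum_(1 <= i < n) ((b * i%:R + m)^-1 - J i) @[n --> \oo] --> V ->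
  mu2.-integrable unit_square (fun z => (integrand36 a b c m z.1 z.2)%:E) /\
  (\int[mu2]_(z in unit_square) (integrand36 a b c m z.1 z.2)%:E = V%:E)%E.
Proof.
move=> b0 mb ma mc hJ hV.
have mS := @measurable_unit_square R.
have bim i : 0 < b * i.+1%:R + m.
  have : b <= b * i.+1%:R by rewrite ler_pMr// ler1n.
  lra.
have hm i : (\int[mu2]_(z in unit_square)
    (log_kernel (b * i.+1%:R + m) (b * i.+1%:R + m) z)%:E
    = (b * i.+1%:R + m)^-1%:E)%E.
  by rewrite integral_log_kernel// integral_inv_sqr.
pose t i z := log_kernel (b * i.+1%:R + m) (b * i.+1%:R + m) z
  - log_kernel (b * i.+1%:R + a) (b * i.+1%:R + c) z.
have t0 i z : unit_square z -> 0 <= t i z.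
  by move=> Sz; rewrite subr_ge0 log_kernel_le// lerD2l.
have mt i (D : set (R * R)) : measurable_fun D (t i).
  by apply: measurable_funB; exact: measurable_log_kernel.
have it i : (\int[mu2]_(z in unit_square) (t i z)%:E
    = ((b * i.+1%:R + m)^-1 - J i.+1)%:E)%E.
  rewrite EFinB -hm -hJ -integralB_EFin//.
  - apply: (ge0_integrable_EFin _ _ (hm i)) => [|z]; first exact: measurable_log_kernel.
    exact: log_kernel_ge0.
  - apply: (ge0_integrable_EFin _ _ (hJ i)) => [|z]; first exact: measurable_log_kernel.
    exact: log_kernel_ge0.
(* Index [i] stands for the series term [i + 1]: the factor [(x y)^b] in the numerator makes the
   geometric series start at its first power. *)
pose g n z := (\sum_(0 <= i < n) t i z)%R.
have g0 n z : unit_square z -> 0 <= g n z.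
  by move=> Sz; apply: sumr_ge0 => i _; exact: t0.
have mg n (D : set (R * R)) : measurable_fun D (g n).
  by apply: measurable_sum.
have ig n : (\int[mu2]_(z in unit_square) (g n z)%:E
    = (\sum_(1 <= i < n.+1) ((b * i%:R + m)^-1 - J i))%:E)%E.
  under eq_integral do rewrite -sumEFin.
  rewrite ge0_integral_sum//; last by move=> i; apply/measurable_EFinP; exact: mt.
  rewrite big_add1/= -sumEFin; apply: eq_bigr => i _; exact: it.
have gl z : unit_square z -> g n z @[n --> \oo] --> integrand36 a b c m z.1 z.2.
  move=> Sz; rewrite integrand36_log_kernel//.
  set q := _ `^ b; set W := _ - _.
  have q1 : q < 1 by have [_ _ _ _ xy] := unit_squareP Sz; exact: powR_lt1.
  have := @cvg_geometric_series R (q * W) q; rewrite ger0_norm ?powR_ge0// => /(_ q1).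
  have -> // : series (geometric (q * W) q) = g ^~ z.
  apply/funext => n; rewrite /series/= /g; apply: eq_bigr => i _.
  by rewrite /t !log_kernel_arith// -/q -mulrBr -/W exprS mulrAC.
have hint : (\int[mu2]_(z in unit_square) (integrand36 a b c m z.1 z.2)%:E = V%:E)%E.
  have hig : ((\int[mu2]_(z in unit_square) (g n z)%:E) @[n --> \oo] --> V%:E)%E.
    rewrite (_ : (fun n => _) = EFin \o
      (fun n : nat => \sum_(1 <= i < n.+1) ((b * i%:R + m)^-1 - J i))).
      by apply: cvg_EFin; [exact: nearW|rewrite -cvg_shiftS in hV].
    by apply/funext => n; exact: ig.
  have h := @cvg_monotone_convergence _ _ R mu2 unit_square mS (fun n z => (g n z)%:E).
  have -> : (\int[mu2]_(z in unit_square) (integrand36 a b c m z.1 z.2)%:E)%E =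
     (\int[mu2]_(z in unit_square) limn (fun n => (g n z)%:E))%E.
    apply: eq_integral => z; rewrite inE => Sz; apply/esym/cvg_lim => //.
    by apply: cvg_EFin; [exact: nearW|exact: gl].
  apply: (cvg_unique _ (h _ _ _)) => //.
  - by move=> n; apply/measurable_EFinP; exact: mg.
  - move=> z Sz; apply/nondecreasing_seqP => n.
    by rewrite lee_fin /g big_nat_recr//= lerDl t0.
split => //; apply: (ge0_integrable_EFin _ _ hint).
  exact: measurable_integrand36.
move=> z Sz; have [_ _ _ _ xy] := unit_squareP Sz.
rewrite integrand36_log_kernel// mulr_ge0//.
  by rewrite mulr_ge0 ?powR_ge0// subr_ge0 log_kernel_le.
by rewrite invr_ge0 subr_ge0 ltW// powR_lt1.
Qed.

End integrand.

(** * General parameters, and passage to the closed square *)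

Section assembly.
Variable R : realType.
Notation mu := (@lebesgue_measure R).
Notation mu2 := (mu \x mu)%E.
Implicit Types a b c d : R.

Lemma arith_gt0 b r (i : nat) : 0 < b -> 0 < r + b -> 0 < b * i.+1%:R + r.
Proof. by move=> b0 rb; have : b <= b * i.+1%:R by [rewrite ler_pMr// ler1n]; lra. Qed.

(* With [m = min a c d], [integrand36 a b c d] is the difference of the
   nonnegative functions [integrand36 a b c m] and [integrand36 d b d m]. *)
Lemma integral_integrand36 a b c d :
  0 < b -> 0 < a + b -> 0 < c + b -> 0 < d + b -> c != a ->
  mu2.-integrable unit_square (fun z => (integrand36 a b c d z.1 z.2)%:E) /\
  (\int[mu2]_(z in unit_square) (integrand36 a b c d z.1 z.2)%:E
   = (closed36 a b c d)%:E)%E.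
Proof.
move=> b0 ab cb db ca.
have mS := @measurable_unit_square R.
pose m := Num.min d (Num.min a c).
have ma : m <= a by rewrite /m !ge_min lexx !orbT.
have mc : m <= c by rewrite /m !ge_min lexx !orbT.
have md : m <= d by rewrite /m ge_min lexx.
have mb : 0 < m + b.
  by rewrite -ltrBlDr sub0r /m !lt_min; apply/and3P; split; lra.
pose J i := ln (1 + (c - a) / (b * i%:R + a)) / (c - a).
have [i|/=|i1 v1] := @integral_integrand36_ge0 R a b c m J (closed36 a b c m) b0 mb ma mc.
- have p := arith_gt0 i b0 ab; have q := arith_gt0 i b0 cb.
  rewrite integral_log_kernel// integral_inv_mul//; last first.
    by rewrite (inj_eq (addrI _)) eq_sym.
  congr EFin; rewrite /J -ln_div ?posrE//.
  have -> : b * i.+1%:R + c - (b * i.+1%:R + a) = c - a by ring.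
  by congr (ln _ / _); move: p => /gt_eqF; move: i.+1%:R => u p; field; rewrite p.
- have := cvg_sum_term36 b0 ab cb mb ca.
  rewrite (_ : (fun n => _) = (fun n : nat =>
    \sum_(1 <= i < n) ((b * i%:R + m)^-1 - J i))) //.
  by apply/funext => n; apply: eq_bigr => i _; rewrite /term36 div1r.
(* In the second piece [a] and [c] are both replaced by [d], so its series is a difference of
   reciprocals and sums to a difference of digamma values. *)
have [i|i2 v2] := @integral_integrand36_ge0 R d b d m (fun i => (b * i%:R + d)^-1) _ b0 mb md md
  _ (cvg_sum_invrB b0 mb db).
- have p := arith_gt0 i b0 db.
  by rewrite integral_log_kernel// integral_inv_sqr.
have E z : z \in unit_square -> (integrand36 a b c d z.1 z.2)%:E =
    ((integrand36 a b c m z.1 z.2)%:E - (integrand36 d b d m z.1 z.2)%:E)%E.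
  rewrite inE => Sz; rewrite -EFinB; congr EFin.
  by rewrite !integrand36_log_kernel//; ring.
split.
  have h := integrableB _ i1 i2.
  by apply: eq_integrable (h _) => // z Sz; rewrite [RHS]E.
transitivity (\int[mu2]_(z in unit_square)
    ((integrand36 a b c m z.1 z.2)%:E - (integrand36 d b d m z.1 z.2)%:E))%E.
  by apply: eq_integral => z Sz; rewrite [LHS]E.
apply: (eq_trans (integralB_EFin _ i1 i2)) => //.
(* The digamma values at [(b + m) / b] cancel between the two pieces. *)
rewrite v1 v2 -EFinB; congr EFin; rewrite /closed36.
move: (ln _) (digamma _) (digamma _) => u v w; ring.
Qed.

Lemma unit_square_sub :
  (unit_square : set (R * R)) `<=` `[0, 1]%classic `*` `[0, 1]%classic.
Proof.
move=> [x y] /unit_squareP[/= x0 x1 y0 y1 _].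
by split; rewrite /= in_itv/= !ltW.
Qed.

Lemma closed_squareD :
  (`[0, 1]%classic `*` `[0, 1]%classic)
    `\` ((`[0, 1]%classic `*` `[0, 1]%classic) `\` unit_square)
  = unit_square :> set (R * R).
Proof. by rewrite setDD setIidr//; exact: unit_square_sub. Qed.

(** The open and the closed square both have measure 1. *)
Lemma mu2_closed_squareD :
  mu2 ((`[0, 1]%classic `*` `[0, 1]%classic) `\` unit_square) = 0%E.
Proof.
have mC : measurable (`[0, 1]%classic `*` `[0, 1]%classic : set (R * R)).
  exact: measurableX.
have ec : mu `[0, 1]%classic = 1%E.
  by rewrite lebesgue_measure_itv/= lte_fin ltr01 oppr0 adde0.
have eo : mu `]0, 1[%classic = 1%E.
  by rewrite lebesgue_measure_itv/= lte_fin ltr01 oppr0 adde0.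
have mD : mu2 (`[0, 1]%classic `*` `[0, 1]%classic) = 1%E.
  rewrite product_measure1E//; apply: (etrans (congr2 mule ec ec)).
  by rewrite mule1.
have mO : mu2 unit_square = 1%E.
  rewrite product_measure1E//; apply: (etrans (congr2 mule eo eo)).
  by rewrite mule1.
have mI : mu2 ((`[0, 1]%classic `*` `[0, 1]%classic) `&` unit_square) = 1%E.
  by rewrite setIidr//; exact: unit_square_sub.
have fC : (mu2 (`[0%R, 1%R]%classic `*` `[0%R, 1%R]%classic) < +oo)%E by rewrite mD ltry.
rewrite measureD//; last exact: measurable_unit_square.
by apply: (etrans (congr2 (fun u v => u - v)%E mD mI)); rewrite subee.
Qed.

End assembly.

Theorem theorem3p6 (R : realType) (a b c d : R)
  (hb : 0 < b) (hab : 0 < a + b) (hcb : 0 < c + b) (hdb : 0 < d + b)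
  (hac : c != a) :
  ((@lebesgue_measure R \x @lebesgue_measure R)%E).-integrable
     (`[0%R, 1%R] `*` `[0%R, 1%R])
     (fun z : R * R => (integrand36 a b c d z.1 z.2)%:E)
  /\ (\int[@lebesgue_measure R]_(y in `[0%R, 1%R])
        \int[@lebesgue_measure R]_(x in `[0%R, 1%R])
          (integrand36 a b c d x y)%:E
      = (closed36 a b c d)%:E)%E
  /\ (fun N : nat => \sum_(1 <= n < N) term36 a b c d n) @ \oo
       --> closed36 a b c d.
Proof.
have [iO vO] := integral_integrand36 hb hab hcb hdb hac.
have mO := @measurable_unit_square R.
have mC : measurable (`[0, 1]%classic `*` `[0, 1]%classic : set (R * R)).
  exact: measurableX.
have mF D : measurable_fun D (fun z : R * R => (integrand36 a b c d z.1 z.2)%:E).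
  by apply/measurable_EFinP; exact: measurable_integrand36.
(* The edges form a null set, so the values that the integrand takes there by convention do not
   matter. *)
have iC : ((@lebesgue_measure R \x @lebesgue_measure R)%E).-integrable
     (`[0%R, 1%R] `*` `[0%R, 1%R])
     (fun z : R * R => (integrand36 a b c d z.1 z.2)%:E).
  apply: (iffRL (@negligible_integrable _ _ R (lebesgue_measure \x lebesgue_measure)%E _
    ((`[0, 1]%classic `*` `[0, 1]%classic) `\` unit_square) _ _ _ _ _)) => //.
  - exact: measurableD.
  - exact: mF.
  - exact: mu2_closed_squareD.
  - by rewrite closed_squareD.
split => //; split; last exact: cvg_sum_term36.
rewrite -vO.
(* The integrand may change sign, so the iterated integral is reached by Fubini from the
   integrability just shown. *)
rewrite (@integrable_fubini_setX _ _ _ _ R lebesgue_measure lebesgue_measure _ _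
  (fun z : R * R => (integrand36 a b c d z.1 z.2)%:E))//.
apply: (etrans (@negligible_integral _ _ R (lebesgue_measure \x lebesgue_measure)%E _
    ((`[0, 1]%classic `*` `[0, 1]%classic) `\` unit_square) _ _ _ _ _)) => //.
- exact: measurableD.
- exact: mu2_closed_squareD.
- by rewrite closed_squareD.
Qed.
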